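(* Let $n > 2f$. In an anonymous asynchronous message-passing system of $n$ processes, at most $f$ of which may crash, augmented with the failure detector $\diamond\mathcal{N}$, Algorithm 2 (given in the context) solves the (binary) consensus problem: every execution satisfies Termination, Irrevocability (Integrity), Agreement and Validity.
   Context: Model. $P=\{p_1,\dots,p_n\}$ is a set of $n$ processes; time ranges over $\mathbb{N}$. A failure pattern is a function $F:\mathbb{N}\to 2^P$, where $F(t)$ is the set of processes that have crashed by time $t$; processes fail only by crashing (halting permanently), so $F(t)\subseteq F(t+1)$. Put $crashed(F)=\bigcup_{t}F(t)$ and $correct(F)=P\setminus crashed(F)$; at least one process is correct, and $|crashed(F)|\le f$. The system is asynchronous: every pair of processes is connected by a reliable channel, with unbounded but finite message delays. The primitive broadcast$(m)$ sends $m$ to every process, including the sender. The system is anonymous: all processes run the same code, and a receiver cannot tell who sent a message; formally, if $R_i(j,t)$ is the value process $i$ receives from process $j$ at time $t$, the anonymous receive operation yields $R_i^{\Pi}(j,t)=R_i(\Pi(j),t)$ for a permutation $\Pi$ of $P$. Received messages are placed in a multiset $received$. Only messages of the round a process is currently in are considered; messages of later rounds are delayed until that round starts, and those of earlier rounds may be discarded. Failure detector $\diamond\mathcal{N}$. A history is a function $H:P\times\mathbb{N}\to\{0,\dots,n\}$, where $H(q,t)$ is the number of processes that $q$'s module suspects to have crashed at time $t$. It is admissible for $F$ iff: (Completeness) there is $t$ such that $H(q,t')\ge |crashed(F)|$ for all $t'\ge t$ and $q\in P$; (Eventual Accuracy) there is $t$ such that $H(q,t')\le |crashed(F)|$ for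 all $t'>t$ and $q\in correct(F)$. In the algorithm, $\diamond\mathcal{N}$ denotes the number of processes currently believed to be alive; since it is always safe to wait for $n-f$ processes, this value is always at least $n-f$, i.e. it is $\max\{n-H(q,t),\,n-f\}$ at process $q$ at time $t$. Consensus. Each process has an input (proposed) value in $\{0,1\}$. Termination: every correct process eventually decides some value. Irrevocability (Integrity): every process decides at most once. Agreement: no two correct processes decide differently. Validity: if a process decides $v$, then $v$ was proposed by some process. Algorithm 2 (code for each process; ''$\_$'' stands for an arbitrary entry, ''?'' is a special symbol not in $\{0,1\}$). Initially $v\in\{0,1\}$ is the input value, $lock\leftarrow ?$, $decided\leftarrow false$, $r\leftarrow 0$. Loop forever: (1) broadcast $(Propose,r,v)$; (2) wait until $received$ contains $(Propose,r,\_)$ at least $\diamond\mathcal{N}$ times; (3) $proposed\leftarrow\{w:(Propose,r,w)\in received\}$; (4) $v\leftarrow\min(proposed)$; (5) if $proposed\setminus\{v\}=\emptyset$ then $lock\leftarrow v$, else $lock\leftarrow ?$; (6) broadcast $(Lock,r,lock,v)$; (7) if $decided$ then halt; (8) wait until $received$ contains $(Lock,r,\_,\_)$ at least $\diamond\mathcal{N}$ times; (9) $locked\leftarrow\{w:(Lock,r,w,\_)\in received\}$; (10) if $locked\setminus\{?\}\neq\emptyset$ then: $v\leftarrow\min(locked\setminus\{?\})$, and if moreover $locked\setminus\{v\}=\emptyset$ then decide $v$ and set $decided\leftarrow true$; (11) else (i.e. $locked\setminus\{?\}=\emptyset$): $proposed\leftarrow\{w:(Lock,r,\_,w)\in received\}$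 and $v\leftarrow\min(proposed)$; (12) $r\leftarrow r+1$. *)

(* Defs.v *)
From HB Require Import structures.
From mathcomp Require Import all_boot all_order all_fingroup.
From mathcomp Require Import boolp.

Set Implicit Arguments.
Unset Strict Implicit.
Unset Printing Implicit Defensive.

Section Environment.
Variable n : nat.
Implicit Types (F : nat -> {set 'I_n}) (H : 'I_n -> nat -> 'I_n.+1).

Definition crashed F : {set 'I_n} := [set p | `[< exists t, p \in F t >]].

Definition correct F : {set 'I_n} := ~: crashed F.

Definition failure_pattern (f : nat) F : Prop :=
  [/\ forall t, F t \subset F t.+1,
      correct F != set0
    & #|crashed F| <= f].

Definition completeness F H : Prop :=
  exists t, forall t' q, t <= t' -> #|crashed F| <= H q t'.

Definition eventual_accuracy F H : Prop :=
  exists t, forall t' q, t < t' -> q \in correct F -> H q t' <= #|crashed F|.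

Definition admissible F H : Prop := completeness F H /\ eventual_accuracy F H.

(* The detector <>N as read by the code: [H q t] counts the suspected processes,
   the code uses the number of those believed alive, at least [n - f]. *)
Definition alive (f : nat) H (q : 'I_n) (t : nat) : nat :=
  maxn (n - H q t) (n - f).

End Environment.

(* The binary values 0 and 1 are [false] and [true]; in the lock entry of a
   message (and in the variable lock) the symbol "?" is [None].
   A message carries no trace of its sender. *)
Inductive message : Type :=
| Propose of nat & bool
| Lock of nat & option bool & bool.

Definition message_code (m : message) :
    (nat * bool) + (nat * option bool * bool) :=
  match m with
  | Propose r w => inl (r, w)
  | Lock r l w => inr (r, l, w)
  end.

Definition message_decode (x : (nat * bool) + (nat * option bool * bool)) :=
  match x with
  | inl (r, w) => Propose r w
  | inr (r, l, w) => Lock r l w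
  end.

Lemma message_codeK : cancel message_code message_decode.
Proof. by case. Qed.

HB.instance Definition _ := Equality.copy message (can_type message_codeK).

Definition is_propose (r : nat) (m : message) : bool :=
  if m is Propose r' _ then r' == r else false.

Definition is_lock (r : nat) (m : message) : bool :=
  if m is Lock r' _ _ then r' == r else false.

(* The minimum of a nonempty set of binary values (1 if the set is empty). *)
Definition vmin (A : {set bool}) : bool := \big[Order.min/true]_(w in A) w.

(* [Lk] is line (k) of the algorithm. *)
Inductive line : Type :=
| L1 | L2 | L3 | L4 | L5 | L6 | L7 | L8 | L9 | L10 | L11 | L12 | Halted.

Section Code.
Variable n : nat.

(* Besides the program variables:
   - [received] is a multiset, of which only [count] and membership are used;
     it keeps the messages of every round, and the code looks only at those of
     the current round;
   - [pending] is the set of processes to which the broadcast being executed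
     still has to send its message (everybody, outside of a broadcast);
   - [decisions] is the log of the "decide" instructions executed. *)
Record local : Type := Local {
  pc : line;
  var_v : bool;
  var_lock : option bool;
  var_decided : bool;
  var_r : nat;
  var_proposed : {set bool};
  var_locked : {set option bool};
  received : seq message;
  pending : {set 'I_n};
  decisions : seq bool
}.

Definition initial (w : bool) : local :=
  Local L1 w None false 0 set0 set0 [::] setT [::].

(* Execution of one line other than a broadcast, when the failure detector
   returns [fd].  A wait whose condition does not hold leaves the state
   unchanged (the condition is polled again at the next step). *)
Definition exec (fd : nat) (s : local) : local :=
  let: Local l v lk dec r prop lckd rcv pend ds := s in
  match l with
  | L2 => Local (if fd <= count (is_propose r) rcv then L3 else L2)
                v lk dec r prop lckd rcv pend ds
  | L3 => Local L4 v lk dec r [set w | Propose r w \in rcv] lckd rcv pend ds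
  | L4 => Local L5 (vmin prop) lk dec r prop lckd rcv pend ds
  | L5 => Local L6 v (if prop :\ v == set0 then Some v else None)
                dec r prop lckd rcv pend ds
  | L7 => Local (if dec then Halted else L8)
                v lk dec r prop lckd rcv pend ds
  | L8 => Local (if fd <= count (is_lock r) rcv then L9 else L8)
                v lk dec r prop lckd rcv pend ds
  | L9 => Local L10 v lk dec r prop
                [set w | [exists u, Lock r w u \in rcv]] rcv pend ds
  | L10 =>
      if lckd :\ None != set0 then
        let v' := vmin [set w | Some w \in lckd] in
        if lckd :\ Some v' == set0
        then Local L12 v' lk true r prop lckd rcv pend (rcons ds v')
        else Local L12 v' lk dec r prop lckd rcv pend ds
      else Local L11 v lk dec r prop lckd rcv pend ds
  | L11 =>
      let prop' := [set w | [exists u, Lock r u w \in rcv]] in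
      Local L12 (vmin prop') lk dec r prop' lckd rcv pend ds
  | L12 => Local L1 v lk dec r.+1 prop lckd rcv pend ds
  | L1 | L6 | Halted => s
  end.

(* The message being broadcast, if the current line is a broadcast. *)
Definition outgoing (s : local) : option message :=
  match pc s with
  | L1 => Some (Propose (var_r s) (var_v s))
  | L6 => Some (Lock (var_r s) (var_lock s) (var_v s))
  | _ => None
  end.

(* The state of a broadcasting process after the sending to [j]. *)
Definition sent (j : 'I_n) (s : local) : local :=
  let: Local l v lk dec r prop lckd rcv pend ds := s in
  if pend :\ j == set0
  then Local (if l is L1 then L2 else L7) v lk dec r prop lckd rcv setT ds
  else Local l v lk dec r prop lckd rcv (pend :\ j) ds.

Definition receive (m : message) (s : local) : local :=
  let: Local l v lk dec r prop lckd rcv pend ds := s in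
  Local l v lk dec r prop lckd (m :: rcv) pend ds.

(* [channel c (j, i)] is the multiset of the messages in transit from [j]
   to [i]. *)
Record config : Type := Config {
  state : {ffun 'I_n -> local};
  channel : {ffun 'I_n * 'I_n -> seq message}
}.

Definition set_state (c : config) (i : 'I_n) (s : local) : config :=
  Config [ffun k => if k == i then s else state c k] (channel c).

Definition set_channel (c : config) (e : 'I_n * 'I_n) (ms : seq message) :=
  Config (state c) [ffun k => if k == e then ms else channel c k].

(* A broadcast is a sequence of [Send]s, in any order, and may be interrupted
   by a crash.  In [Receive i k m], [k] is the anonymous name, for the receiver
   [i], of the sender. *)
Inductive event : Type :=
| Idle
| Send of 'I_n & 'I_n
| Run of 'I_n
| Receive of 'I_n & 'I_n & message.

Variables (f : nat) (Pi : {perm 'I_n}) (F : nat -> {set 'I_n}).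
Variables (H : 'I_n -> nat -> 'I_n.+1) (input : 'I_n -> bool).

Definition initial_config : config :=
  Config [ffun i => initial (input i)] [ffun=> [::]].

Definition transition (t : nat) (e : event) (c c' : config) : Prop :=
  match e with
  | Idle => c' = c
  | Send i j =>
      [/\ i \notin F t, j \in pending (state c i)
        & exists2 m, outgoing (state c i) = Some m
          & c' = set_state (set_channel c (i, j) (m :: channel c (i, j)))
                           i (sent j (state c i))]
  | Run i =>
      [/\ i \notin F t, outgoing (state c i) = None
        & c' = set_state c i (exec (alive f H i t) (state c i))]
  | Receive i k m =>
      let e := (Pi k, i) in
      [/\ i \notin F t, m \in channel c e
        & c' = set_state (set_channel c e (rem m (channel c e)))
                         i (receive m (state c i))]
  end.

Definition is_step_of (i : 'I_n) (e : event) : Prop :=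
  e = Run i \/ exists j, e = Send i j.

(* [ev t] occurs at time [t] and leads from [conf t] to [conf t.+1].  Correct
   processes take infinitely many steps ([Run] has no effect on a halted
   process), and messages to correct processes are eventually received. *)
Record execution (ev : nat -> event) (conf : nat -> config) : Prop :=
  Execution {
    exec_init : conf 0 = initial_config;
    exec_step : forall t, transition t (ev t) (conf t) (conf t.+1);
    exec_fair : forall i, i \in correct F ->
      forall t, exists2 t', t <= t' & is_step_of i (ev t');
    exec_reliable : forall i k m t, i \in correct F ->
      m \in channel (conf t) (Pi k, i) ->
      exists2 t', t <= t' & ev t' = Receive i k m
  }.

Definition decides (conf : nat -> config) (i : 'I_n) (w : bool) : Prop :=
  exists t, w \in decisions (state (conf t) i).

Definition termination (conf : nat -> config) : Prop :=
  forall i, i \in correct F -> exists w, decides conf i w.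

Definition irrevocability (conf : nat -> config) : Prop :=
  forall i t, size (decisions (state (conf t) i)) <= 1.

Definition agreement (conf : nat -> config) : Prop :=
  forall i j w w', i \in correct F -> j \in correct F ->
    decides conf i w -> decides conf j w' -> w = w'.

Definition validity (conf : nat -> config) : Prop :=
  forall i w, decides conf i w -> exists j, input j = w.

End Code.

(* Main.v *)
(* Messages of one round received by one process come from distinct processes,
   so any two quorums of n - f > n/2 of them share a sender.  Hence two locks
   other than "?" taken in the same round agree, and once somebody decides a in
   round r, every process that completes round r leaves it with value a; from
   then on all proposals and locks are a, which gives agreement.
   For termination, if some correct process never decided, no correct process
   would block, so all of them would enter every round.  Take a round R entered
   by nobody before the crashes are over and the detector is accurate: its waits
   end only with a message from each correct process, so all correct processes
   see the same proposals, take the same lock and leave R either decided or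
   with a common value, on which they decide in round R + 1. *)

Require Import Defs.
From HB Require Import structures.
From mathcomp Require Import all_boot all_order all_fingroup.
From mathcomp Require Import boolp zify.

Set Implicit Arguments.
Unset Strict Implicit.
Unset Printing Implicit Defensive.

(** * Minima of sets of binary values *)

Lemma vminE (A : {set bool}) : vmin A = (false \notin A).
Proof.
(* On booleans ordered by false < true, the minimum is conjunction. *)
have -> : vmin A = \big[andb/true]_(w in A) w.
  by apply: (big_rec2 eq) => // -[] [] _ _ <-.
rewrite big_andE; apply/forall_inP/idP => [minA|fA [] // fA'].
  by apply/negP=> /minA.
by rewrite fA' in fA.
Qed.

Lemma vmin_in (A : {set bool}) : A != set0 -> vmin A \in A.
Proof.
rewrite vminE; case: (boolP (false \in A)) => //= fA /set0Pn[[] //].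
by rewrite (negbTE fA).
Qed.

Lemma vmin1 (a : bool) : vmin [set a] = a.
Proof. by rewrite vminE inE; case: a. Qed.

Lemma setD1_eq0 (T : finType) (A : {set T}) (a : T) :
  (A :\ a == set0) = (A \subset [set a]).
Proof. by rewrite setD_eq0. Qed.

(** * Samples of values taken from sufficiently many processes *)

Section Samples.
Variables (n : nat) (T : finType).
Implicit Types (R : 'I_n -> T -> Prop) (A B : {set T}).

(** Models the set of values read off a bag of messages, [R j x] meaning that [j] stated [x]: at
    least [k] distinct processes are heard in [A], and each element of [A] has a source. *)
Definition sample (k : nat) R A : Prop :=
  (exists2 S : {set 'I_n}, k <= #|S|
     & forall j, j \in S -> exists2 x, x \in A & R j x)
  /\ forall x, x \in A -> exists j, R j x.

Lemma sample_neq0 k R A : 0 < k -> sample k R A -> A != set0.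
Proof.
move=> k0 [[S /(leq_trans k0)/card_gt0P[j jS] /(_ j jS)[x xA _]] _].
by apply/set0Pn; exists x.
Qed.

(** Two sets of more than [n / 2] processes share a member, and [R] gives this member a single
    value. *)
Lemma sample_meet k R A B :
  n < 2 * k -> (forall j x y, R j x -> R j y -> x = y) ->
  sample k R A -> sample k R B -> exists2 x, x \in A & x \in B.
Proof.
move=> nk inj [[S kS SA] _] [[S' kS' SB] _].
have /set0Pn[j] : S :&: S' != set0.
  rewrite -card_gt0; have := cardsUI S S'.
  have := max_card (mem (S :|: S')); rewrite card_ord => h1 h2.
  rewrite -(ltn_add2l #|S :|: S'|) addn0 h2.
  apply: leq_ltn_trans h1 (leq_trans nk _).
  by rewrite mul2n -addnn leq_add.
rewrite inE => /andP[jS jS'].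
have [x xA Rx] := SA _ jS; have [y yB Ry] := SB _ jS'.
by exists x => //; rewrite (inj _ _ _ Rx Ry).
Qed.

Lemma sample_const k R A a :
  0 < k -> (forall j x, R j x -> x = a) -> sample k R A -> A = [set a].
Proof.
move=> k0 Ra sA; have /set0Pn[y yA] := sample_neq0 k0 sA.
have all_a x : x \in A -> x = a by case: sA => _ /[apply] -[j /Ra].
apply/setP=> x; rewrite inE; apply/idP/eqP=> [/all_a //|->].
by rewrite -(all_a _ yA).
Qed.

(* If only k processes have a value at all, a sample of size k misses none. *)
Lemma sample_full R A B (C : {set 'I_n}) :
  (forall j x y, R j x -> R j y -> x = y) -> (forall j x, R j x -> j \in C) ->
  sample #|C| R A -> sample #|C| R B -> A = B.
Proof.
move=> inj RC.
have sub A' B' : sample #|C| R A' -> sample #|C| R B' -> A' \subset B'.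
  move=> [_ A'R] [[S kS SB] _].
  have SC : S = C.
    apply/eqP; rewrite eqEcard kS andbT; apply/subsetP=> j /SB[x _].
    exact: RC.
  apply/subsetP=> x /A'R[j Rx].
  have [|y yB Ry] := SB j; first by rewrite SC; apply: RC Rx.
  by rewrite (inj _ _ _ Rx Ry).
move=> sA sB; apply/eqP; rewrite eqEsubset; apply/andP.
by split; apply: sub.
Qed.

End Samples.

(** * Steps and invariants of a single process *)

Section Local.
Variable n : nat.
Implicit Types s : local n.

Definition line_index (l : line) : nat :=
  match l with
  | L1 => 0 | L2 => 1 | L3 => 2 | L4 => 3 | L5 => 4 | L6 => 5 | L7 => 6
  | L8 => 7 | L9 => 8 | L10 => 9 | L11 => 10 | L12 => 11 | Halted => 12
  end.

(* The rank never decreases, and while it is constant so is the [core]; so what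
   a process says in a given round is a function of its name. *)
Definition rank s : nat := 13 * var_r s + line_index (pc s).

Definition core s := (pc s, var_v s, var_lock s, var_decided s, var_r s).

(** What one process sees of a transition. Any message may be received, so invariants of one process
    involve no channel. *)
Variant local_step (fd : nat) s : local n -> Prop :=
| StayStep : local_step fd s s
| SendStep j m of j \in pending s & outgoing s = Some m :
    local_step fd s (sent j s)
| RunStep of outgoing s = None : local_step fd s (exec fd s)
| ReceiveStep m : local_step fd s (receive m s).

Lemma local_step_rank fd s s' :
  local_step fd s s' -> rank s < rank s' \/ core s = core s'.
Proof.
case=> [|j m _||m]; first by right.
- case: s => [] [] // v lk dec r p lc rc pd ds _ /=; case: ifP => _;
    (by left; rewrite /rank /= ltn_add2l) || by right.
- case: s => [] [] // v lk dec r p lc rc pd ds _ /=;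
    rewrite /rank /core /=; repeat case: ifP => //= _;
    rewrite ?ltn_add2l; auto.
  by left; rewrite mulnS addn0 addnC ltn_add2r.
- by case: s => *; right.
Qed.

(** By the second clause a process that has decided is never at L8 to L11: it halts at L7, so it
    cannot decide twice. The third clause makes every broadcast start with [pending] full. *)
Definition local_inv s : Prop :=
  [/\ size (decisions s) = var_decided s,
      var_decided s -> ~~ (7 <= line_index (pc s) <= 10),
      outgoing s = None -> pending s = setT
    & pending s != set0].

Lemma local_step_inv fd s s' :
  0 < n -> local_step fd s s' -> local_inv s -> local_inv s'.
Proof.
move=> n0; have T0 : [set: 'I_n] != set0.
  by rewrite -card_gt0 cardsT card_ord.
case=> [//|j m _||m].
- case: s => [] [] // v lk dec r p lc rc pd ds _ [/= e h1 h2 h3];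
   case: ifP => /= E; split=> //=; by rewrite E.
- case: s => [] [] // v lk [] r p lc rc pd ds _ [/= e h1 h2 h3];
    try (by have := h1 isT); repeat case: ifP => //= ?; split=> //=.
  by rewrite size_rcons e.
- by case: s.
Qed.

End Local.

(* The rank of the line broadcasting the message: L1 or L6 of its round. *)
Definition message_rank (m : message) : nat :=
  match m with Propose r _ => 13 * r | Lock r _ _ => 13 * r + 5 end.

Lemma is_proposeE r : is_propose r =1 [pred m | message_rank m == 13 * r].
Proof. by case=> /= *; lia. Qed.

Lemma is_lockE r : is_lock r =1 [pred m | message_rank m == 13 * r + 5].
Proof. by case=> /= *; lia. Qed.

Lemma outgoing_rank n (s : local n) m :
  outgoing s = Some m -> message_rank m = rank s.
Proof.
case: s => [] [] //= v lk dec r p lc rc pd ds [<-];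
  rewrite /message_rank /rank /=; lia.
Qed.

(** A step that is not a sending starts off the broadcast lines and jumps over none of them. *)
Lemma exec_rank n fd (s : local n) m : outgoing s = None ->
  (message_rank m < rank (exec fd s)) = (message_rank m < rank s).
Proof.
case: s => [] [] //= v lk dec r p lc rc pd ds _;
  rewrite /rank /=; repeat case: ifP => //= _; case: m => /=; lia.
Qed.

Lemma core_outgoing n (s s' : local n) :
  core s = core s' -> outgoing s = outgoing s'.
Proof.
by case: s s' => ? ? ? ? ? ? ? ? ? ? [? ? ? ? ? ? ? ? ? ?] [-> -> -> _ ->].
Qed.

(** * Executions: monotonicity of ranks and uniqueness of what is said *)

Section Execution.
Variables (n f : nat) (Pi : {perm 'I_n}) (F : nat -> {set 'I_n}).
Variables (H : 'I_n -> nat -> 'I_n.+1) (input : 'I_n -> bool).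
Variables (ev : nat -> event n) (conf : nat -> config n).
Hypothesis n_gt0 : 0 < n.
Hypothesis exn : execution f Pi F H input ev conf.

Local Notation st t i := (state (conf t) i).

Lemma process_step i t : local_step (alive f H i t) (st t i) (st t.+1 i).
Proof.
have := exec_step exn t; case: (ev t) => [->|k j|k|k j m] /=.
- exact: StayStep.
- case=> _ jp [m om ->]; rewrite /= ffunE; case: eqP => [->|_].
    exact: SendStep jp om.
  exact: StayStep.
- case=> _ om ->; rewrite /= ffunE; case: eqP => [->|_].
    exact: RunStep.
  exact: StayStep.
- case=> _ _ ->; rewrite /= ffunE; case: eqP => [->|_].
    exact: ReceiveStep.
  exact: StayStep.
Qed.

Lemma crashed_stay i t : i \in F t -> st t.+1 i = st t i.
Proof.
move=> iF; have := exec_step exn t; case: (ev t) => [->//|k j|k|k j m] /=.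
- by case=> kF _ [m _ ->]; rewrite /= ffunE; case: eqP kF iF => // -> /negbTE->.
- by case=> kF _ ->; rewrite /= ffunE; case: eqP kF iF => // -> /negbTE->.
- by case=> kF _ ->; rewrite /= ffunE; case: eqP kF iF => // -> /negbTE->.
Qed.

Lemma state0 i : st 0 i = initial n (input i).
Proof. by rewrite (exec_init exn) /= ffunE. Qed.

Lemma local_invP i t : local_inv (st t i).
Proof.
elim: t => [|t]; last by apply: local_step_inv (process_step i t).
rewrite state0; split => //=; by rewrite -card_gt0 cardsT card_ord.
Qed.

Lemma rank_mono i t t' : t <= t' -> rank (st t i) <= rank (st t' i).
Proof.
elim: t' => [|t' IH]; first by rewrite leqn0 => /eqP->.
rewrite leq_eqVlt => /orP[/eqP->//|/IH le]; apply: leq_trans le _.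
have [/ltnW//|[e1 _ _ _ e2]] := local_step_rank (process_step i t').
by rewrite /rank e1 e2.
Qed.

Lemma rank_core i t t' :
  rank (st t i) = rank (st t' i) -> core (st t i) = core (st t' i).
Proof.
wlog le : t t' / t <= t'.
  by move=> W; case: (leqP t t') => [/W//|/ltnW/W h /esym/h->].
elim: t' le => [|t' IH]; first by rewrite leqn0 => /eqP->.
rewrite leq_eqVlt => /orP[/eqP->//|le] e; have := @rank_mono i t t' le.
have [lt|e'] := local_step_rank (process_step i t') => mono.
  by move: lt; rewrite -e ltnNge mono.
by rewrite -e' IH // e; case: e' => e1 _ _ _ e2; rewrite /rank e1 e2.
Qed.

Lemma round_mono i t t' : t <= t' -> var_r (st t i) <= var_r (st t' i).
Proof.
move=> /(rank_mono i); rewrite /rank.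
have lt13 l : line_index l < 13 by case: l.
have := lt13 (pc (st t i)); have := lt13 (pc (st t' i)); lia.
Qed.

(** Being at the broadcast line suffices, even if a crash stops the sending, so this covers
    everything that can be received. *)
Definition said j m : Prop := exists t, outgoing (st t j) = Some m.

Lemma said_inj j m m' :
  said j m -> said j m' -> message_rank m = message_rank m' -> m = m'.
Proof.
move=> [t e] [t' e']; rewrite (outgoing_rank e) (outgoing_rank e').
by move=> /rank_core/core_outgoing; rewrite e e' => -[].
Qed.

(** * Accounting of the messages in each channel *)

Fixpoint sent_log t (e : 'I_n * 'I_n) : seq message :=
  if t is t'.+1 then
    if ev t' is Send i j then
      if (i, j) == e then seq_of_opt (outgoing (st t' i)) ++ sent_log t' e
      else sent_log t' e
    else sent_log t' e
  else [::].

(** Indexed by the true sender [Pi k], which the receiver does not know. *)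
Fixpoint delivered t (e : 'I_n * 'I_n) : seq message :=
  if t is t'.+1 then
    if ev t' is Receive i k m then
      if (Pi k, i) == e then m :: delivered t' e else delivered t' e
    else delivered t' e
  else [::].

Lemma count_channel t e a :
  count a (delivered t e) + count a (channel (conf t) e) =
  count a (sent_log t e).
Proof.
elim: t => [|t IH] /=; first by rewrite (exec_init exn) /= ffunE.
have := exec_step exn t; case: (ev t) => [->//|i j|i|i k m] /=.
- case=> _ _ [m -> ->] /=; rewrite ffunE [e == _]eq_sym.
  by case: eqP => [->|_] //=; rewrite -IH addnCA.
- by case=> _ _ ->.
- case=> _ mc -> /=; rewrite ffunE [e == _]eq_sym; case: eqP => [E|_] //=.
  rewrite E in mc *; rewrite -IH (seq.permP (perm_to_rem mc)) /=; lia.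
Qed.

Lemma count_received t i a :
  count a (received (st t i)) = \sum_j count a (delivered t (j, i)).
Proof.
elim: t => [|t IH] /=; first by rewrite state0 big1.
have rec_sent j (s : local n) : received (sent j s) = received s.
  by case: s => *; rewrite /=; case: ifP.
have rec_exec fd (s : local n) : received (exec fd s) = received s.
  by case: s => [] [] * //=; repeat case: ifP => //= _.
have := exec_step exn t; case: (ev t) => [->//|i' j|i'|i' k m] /=.
- case=> _ _ [m _ ->] /=; rewrite ffunE.
  by case: eqP => // <-; rewrite rec_sent.
- by case=> _ _ -> /=; rewrite ffunE; case: eqP => // <-; rewrite rec_exec.
case=> _ _ -> /=; rewrite ffunE; case: eqP => [<-|ne].
  have -> (s : local n) : received (receive m s) = m :: received s by case: s.
  rewrite /= IH [RHS](bigD1 (Pi k)) //= eqxx [in LHS](bigD1 (Pi k)) //= -addnA.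
  congr (_ + (_ + _)); apply: eq_bigr => j jk.
  by rewrite xpair_eqE eq_sym (negbTE jk).
rewrite IH; apply: eq_bigr => j _; rewrite xpair_eqE andbC.
by case: eqP => // e; case: ne.
Qed.

(** The broadcast of a given rank is executed at most once, so a channel gets at most one message of
    that rank: it has got it when the sender is past the rank, or at it with [i] already served. *)
Lemma count_sent t i j m0 :
  count [pred m | message_rank m == message_rank m0] (sent_log t (j, i)) =
  (message_rank m0 < rank (st t j))
  || (rank (st t j) == message_rank m0) && (i \notin pending (st t j)).
Proof.
elim: t => [|t IH] /=.
  by rewrite state0 /rank /= in_setT andbF.
have := local_invP j t; have := exec_step exn t.
case: (ev t) => [->//|j' i'|j'|j' k m] /=.
- case=> _ ip [m om ->] /=; rewrite ffunE xpair_eqE eq_sym.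
  case: eqP => [Ej|//] /=; rewrite -{}Ej in ip om * => -[_ _ _ _].
  have := outgoing_rank om; move: om ip IH.
  case: (st t j) => l v lk dec r p lc rc pd ds /= om ip IH rk.
  rewrite om /=.
  have -> : count [pred m1 | message_rank m1 == message_rank m0]
     (if i' == i then m :: sent_log t (j, i) else sent_log t (j, i)) =
    ((i' == i) && (message_rank m == message_rank m0)) +
    count [pred m1 | message_rank m1 == message_rank m0] (sent_log t (j, i)).
    by case: eqP => //= _.
  rewrite IH; case: ifP => /= [/eqP pd0|_].
    rewrite in_setT andbF orbF.
    have ipd : i != i' -> i \notin pd.
      move=> ne; apply/negP=> ipd; move/setP/(_ i): pd0.
      by rewrite in_set0 in_setD1 ne ipd.
    have -> : rank (Local (if l is L1 then L2 else L7) v lk dec r p lc rc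
        [set: 'I_n] ds) = (message_rank m).+1.
      by rewrite rk /rank; case: l om {IH rk} => //= _; lia.
    rewrite -rk eq_sym; have [Ei|ne] := eqVneq i i'.
      by rewrite -Ei in ip; rewrite ip /=; lia.
    by rewrite (ipd ne); lia.
  have -> : rank (Local l v lk dec r p lc rc (pd :\ i') ds) = message_rank m.
    by rewrite rk.
  rewrite in_setD1 -rk eq_sym; case: (eqVneq i i') => [Ei|ne] /=;
    last by rewrite add0n.
  by rewrite Ei ip /= andbF andbT orbF; case: ltngtP.
- case=> _ om ->; rewrite /= ffunE; case: eqP => [Ej|_ _]; last exact: IH.
  rewrite -{}Ej in om *.
  have -> fd : pending (exec fd (st t j)) = pending (st t j).
    by case: (st t j) => [] [] * //=; repeat case: ifP => //= _.
  case=> _ _ /(_ om) E _; move: IH; rewrite E in_setT !andbF !orbF => ->.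
  by rewrite exec_rank.
- case=> _ _ ->; rewrite /= ffunE; case: eqP => [<-|_] //.
  by move=> _; rewrite IH; case: (st t j).
Qed.

Lemma sent_said t j i m : m \in sent_log t (j, i) -> said j m.
Proof.
elim: t => //= t IH; case: (ev t) => [|j' i'|j'|j' k m'] //.
case: eqP => // -[-> _].
rewrite mem_cat => /orP[|/IH//]; case E: outgoing => [m'|] //=.
by rewrite inE => /eqP->; exists t.
Qed.

Lemma mem_count (T : eqType) (x : T) s : (x \in s) = (0 < count (pred1 x) s).
Proof. by rewrite -has_count has_pred1. Qed.

Lemma delivered_sent t e m : m \in delivered t e -> m \in sent_log t e.
Proof. by rewrite !mem_count -count_channel; apply: ltn_addr. Qed.

Lemma received_delivered t i m :
  m \in received (st t i) -> exists j, m \in delivered t (j, i).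
Proof.
rewrite mem_count count_received lt0n sum_nat_eq0 => /forallPn[j] /=.
by rewrite -lt0n -mem_count; exists j.
Qed.

Lemma delivered_received t i j m :
  m \in delivered t (j, i) -> m \in received (st t i).
Proof.
by rewrite !mem_count count_received (bigD1 j) //= => h; rewrite ltn_addr.
Qed.

Lemma received_said t i m : m \in received (st t i) -> exists j, said j m.
Proof. by case/received_delivered=> j /delivered_sent/sent_said; exists j. Qed.

(** * Quorums and the history behind each local state *)

Definition quorum (k q : nat) (ms : seq message) : Prop :=
  exists2 S : {set 'I_n}, k <= #|S|
    & forall j, j \in S ->
        exists m, [/\ m \in ms, message_rank m = q & said j m].

(** By [count_sent] a channel carries at most one message of each rank, so counting messages without
    their senders already counts distinct senders. *)
Lemma count_quorum t i k m0 :
  let q := message_rank m0 in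
  k <= count [pred m | message_rank m == q] (received (st t i)) ->
  quorum k q (received (st t i)).
Proof.
move=> q; pose a := [pred m | message_rank m == q]; rewrite -/a => kc.
exists [set j | has a (delivered t (j, i))].
  apply: leq_trans kc _; rewrite count_received.
  rewrite -sum1_card [leqRHS]big_mkcond /=.
  apply: leq_sum => j _; rewrite inE has_count.
  have : count a (delivered t (j, i)) <= 1.
    apply: leq_trans (leq_addr (count a (channel (conf t) (j, i))) _) _.
    rewrite count_channel count_sent.
    by case: (_ || _).
  by case: count => [|[]].
move=> j; rewrite inE => /hasP[m md /eqP mq]; exists m; split => //.
  exact: delivered_received md.
exact: sent_said (delivered_sent md).
Qed.

Definition lock_spec k r l w : Prop :=
  exists A, [/\ sample k (fun j x => said j (Propose r x)) A, w = vmin A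
              & l = if A :\ w == set0 then Some w else None].

Definition locked_sample k r :=
  sample k (fun j l => exists u, said j (Lock r l u)).

Definition locked_value_sample k r :=
  sample k (fun j u => exists l, said j (Lock r l u)).

(** Outcome of lines L9 to L11; [d] tells whether the process decides in this very round. *)
Definition finish_spec k r w d : Prop :=
  exists2 L, locked_sample k r L &
    [/\ L :\ None != set0, w = vmin [set x | Some x \in L]
      & d = (L :\ Some w == set0)]
    \/ [/\ L :\ None == set0, d = false
         & exists2 B, locked_value_sample k r B & w = vmin B].

Definition finishes i r w d : Prop :=
  exists t, [/\ pc (st t i) = L12, var_r (st t i) = r, var_v (st t i) = w
              & var_decided (st t i) = d].

Section Threshold.
Variable th : nat -> nat.
Hypothesis th_alive : forall t i, pc (st t i) = L2 \/ pc (st t i) = L8 ->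
  th (var_r (st t i)) <= alive f H i t.

(* The data a process holds at each line, traced back to what others have said
   at any time.  [th r] bounds the detector from below at the waits of round r:
   [n - f] always, and the number of correct processes in late rounds. *)
Definition hist_inv i (s : local n) : Prop :=
  let: Local l v lk dec r prop lckd rcv _ _ := s in
  let k := th r in
  match l with
  | L1 => if r is r'.+1 then exists d, finishes i r' v d else v = input i
  | L3 => quorum k (13 * r) rcv
  | L4 => sample k (fun j x => said j (Propose r x)) prop
  | L5 => sample k (fun j x => said j (Propose r x)) prop /\ v = vmin prop
  | L6 => lock_spec k r lk v
  | L9 => quorum k (13 * r + 5) rcv
  | L10 => quorum k (13 * r + 5) rcv /\ locked_sample k r lckd
  | L11 => [/\ quorum k (13 * r + 5) rcv, locked_sample k r lckd
             & lckd :\ None == set0]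
  | L12 => finish_spec k r v dec
  | _ => True
  end.

Lemma quorum_cons k q m ms : quorum k q ms -> quorum k q (m :: ms).
Proof.
move=> [S kS Sq]; exists S => // j /Sq[m' [m'ms rk sd]].
by exists m'; rewrite inE m'ms orbT.
Qed.

Lemma quorum_proposed k r ms :
  (forall m, m \in ms -> exists j, said j m) -> quorum k (13 * r) ms ->
  sample k (fun j x => said j (Propose r x)) [set w | Propose r w \in ms].
Proof.
move=> msd [S kS Sq]; split=> [|x]; last by rewrite inE => /msd.
exists S => // j /Sq[[r' w|r' l w] /= [mms rk sd]]; last by lia.
have -> : r = r' by lia.
by exists w; rewrite ?inE.
Qed.

Lemma quorum_locked k r ms :
  (forall m, m \in ms -> exists j, said j m) -> quorum k (13 * r + 5) ms ->
  locked_sample k r [set l | [exists u, Lock r l u \in ms]].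
Proof.
move=> msd [S kS Sq]; split=> [|l]; last first.
  by rewrite inE => /existsP[u /msd[j jm]]; exists j, u.
exists S => // j /Sq[[r' w|r' l w] /= [mms rk sd]]; first by lia.
have -> : r = r' by lia.
by exists l; [rewrite inE; apply/existsP; exists w | exists w].
Qed.

Lemma quorum_locked_value k r ms :
  (forall m, m \in ms -> exists j, said j m) -> quorum k (13 * r + 5) ms ->
  locked_value_sample k r [set w | [exists l, Lock r l w \in ms]].
Proof.
move=> msd [S kS Sq]; split=> [|w]; last first.
  by rewrite inE => /existsP[l /msd[j jm]]; exists j, l.
exists S => // j /Sq[[r' w|r' l w] /= [mms rk sd]]; first by lia.
have -> : r = r' by lia.
by exists w; [rewrite inE; apply/existsP; exists l | exists l].
Qed.

Lemma hist_invP i t : hist_inv i (st t i).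
Proof.
elim: t => [|t]; first by rewrite state0.
have rs := @received_said t i.
have cq := @count_quorum t i (th (var_r (st t i))).
have ta := @th_alive t i.
have [_ dec_line _ _] := local_invP i t.
have fin : pc (st t i) = L12 ->
    finishes i (var_r (st t i)) (var_v (st t i)) (var_decided (st t i)).
  by exists t.
case: (process_step i t) rs cq ta dec_line fin => [//|j m _||m].
- case: (st t i) => [] [] // v lk dec r p lc rc pd ds _ _ _ _ _ _ /=;
    by case: ifP.
- case: (st t i) => [] [] // v lk dec r p lc rc pd ds _ /= rs cq ta dl fin.
  (* The value [true] is arbitrary: this message only stands for its rank. *)
  + move=> _; case: ifP => // le; apply: (cq (Propose r true)) => /=.
    by rewrite -(eq_count (is_proposeE r)); apply: leq_trans (ta _) le; left.
  + exact: quorum_proposed.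
  + by case=> sp ->; exists p.
  + by case: ifP.
  + move=> _; case: ifP => // le; apply: (cq (Lock r None true)) => /=.
    by rewrite -(eq_count (is_lockE r)); apply: leq_trans (ta _) le; right.
  + by move=> q; split=> //; apply: quorum_locked.
  (* By [local_inv] a process at L10 has not decided yet, so the flag at L12 records a decision of
     this round. *)
  + case=> q sl; have -> : dec = false by case: dec dl {fin} => // /(_ isT).
    case: ifP => [ln|/negbFE//].
    by case: ifP => ls /=; exists lc => //; left; split; rewrite // ls.
  + case=> q sl ln; exists lc => //; right; split=> //.
      by case: dec dl {fin} => // /(_ isT).
    exists [set w | [exists u, Lock r u w \in rc]] => //.
    exact: quorum_locked_value.
  + by move=> _; exists dec; apply: fin.
- case: (st t i) => [] [] //= v lk dec r p lc rc pd ds _ _ _ _ _.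
  + exact: quorum_cons.
  + exact: quorum_cons.
  + by case=> q ?; split=> //; apply: quorum_cons.
  + by case=> q ? ?; split=> //; apply: quorum_cons.
Qed.

Lemma lockedP i r l w : said i (Lock r l w) -> lock_spec (th r) r l w.
Proof.
case=> t; have := hist_invP i t.
by case: (st t i) => [] [] //= v lk dec r' p lc rc pd ds h [<- <- <-].
Qed.

Lemma finishesP i r w d : finishes i r w d -> finish_spec (th r) r w d.
Proof.
case=> t; have := hist_invP i t.
by case: (st t i) => [] [] /= v lk dec r' p lc rc pd ds h [] // _ <- <- <-.
Qed.

Lemma proposes0 i w : said i (Propose 0 w) -> w = input i.
Proof.
case=> t; have := hist_invP i t.
by case: (st t i) => [] [] //= v lk dec r' p lc rc pd ds + [E1 E2]; subst.
Qed.

Lemma proposesS i r w : said i (Propose r.+1 w) -> exists d, finishes i r w d.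
Proof.
case=> t; have := hist_invP i t.
by case: (st t i) => [] [] //= v lk dec r' p lc rc pd ds + [E1 E2]; subst.
Qed.

End Threshold.

(** * Safety: locks, agreement and validity *)

Lemma said_propose_inj j r x y :
  said j (Propose r x) -> said j (Propose r y) -> x = y.
Proof. by move=> h /(said_inj h)/(_ erefl)[]. Qed.

Lemma said_lock_inj j r l x l' y :
  said j (Lock r l x) -> said j (Lock r l' y) -> l = l' /\ x = y.
Proof. by move=> h /(said_inj h)/(_ erefl)[]. Qed.

Hypothesis nf : 2 * f < n.

Let th0 t i : pc (st t i) = L2 \/ pc (st t i) = L8 ->
  (fun=> n - f) (var_r (st t i)) <= alive f H i t.
Proof. by rewrite leq_maxr. Qed.

Let nf_gt0 : 0 < n - f. Proof. lia. Qed.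
Let nf_maj : n < 2 * (n - f). Proof. lia. Qed.

Lemma finishes_spec i r w d : finishes i r w d -> finish_spec (n - f) r w d.
Proof. exact: (@finishesP (fun=> n - f) th0). Qed.

Lemma said_lock_spec i r l w : said i (Lock r l w) -> lock_spec (n - f) r l w.
Proof. exact: (@lockedP (fun=> n - f) th0). Qed.

Lemma proposes0_input i w : said i (Propose 0 w) -> w = input i.
Proof. exact: (@proposes0 (fun=> n - f) th0). Qed.

Lemma proposesS_finishes i r w :
  said i (Propose r.+1 w) -> exists d, finishes i r w d.
Proof. exact: (@proposesS (fun=> n - f) th0). Qed.

Lemma lock_value i r a w : said i (Lock r (Some a) w) -> w = a.
Proof. by case/said_lock_spec=> A [_ _]; case: ifP => // _ []. Qed.

(** A lock on a value comes from a sample reduced to that value, and two majority samples of one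
    round meet. *)
Lemma lock_unique i j r a b w w' :
  said i (Lock r (Some a) w) -> said j (Lock r (Some b) w') -> a = b.
Proof.
case/said_lock_spec=> A [sA _]; case: ifP => // + [ea].
rewrite -{w}ea setD1_eq0 => As.
case/said_lock_spec=> B [sB _]; case: ifP => // + [eb].
rewrite -{w'}eb setD1_eq0 => Bs.
have [x xA xB] := sample_meet nf_maj (said_propose_inj^~ r) sA sB.
by have /set1P<- := subsetP As _ xA; have /set1P<- := subsetP Bs _ xB.
Qed.

Lemma lock_constant i r a l w :
  (forall j x, said j (Propose r x) -> x = a) -> said i (Lock r l w) ->
  l = Some a /\ w = a.
Proof.
move=> all_a /said_lock_spec[A [sA -> ->]].
have -> := sample_const nf_gt0 all_a sA.
by rewrite vmin1 setDv eqxx.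
Qed.

(** In a unanimous round every lock is [a], so only [Some a] can be collected. *)
Lemma finishes_constant i r a w d :
  (forall j x, said j (Propose r x) -> x = a) -> finishes i r w d ->
  w = a /\ d = true.
Proof.
move=> all_a /finishes_spec[L sL].
have EL : L = [set Some a].
  by apply: sample_const nf_gt0 _ sL => j l [u /(lock_constant all_a)[]].
have E1 : [set x | Some x \in L] = [set a].
  by apply/setP=> x; rewrite EL !inE; apply/eqP/eqP => [[]|->].
case=> [[_ -> ->]|[/eqP/setP/(_ (Some a))]].
  by rewrite E1 vmin1 EL setDv eqxx.
by rewrite EL !inE eqxx.
Qed.

Lemma finishes_decided i r a : finishes i r a true ->
  exists2 L, locked_sample (n - f) r L & L = [set Some a].
Proof.
case/finishes_spec=> L sL [[_ _ /esym]|[]//]; rewrite setD1_eq0 subset1.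
move=> La; exists L => //; apply/eqP; case/orP: La => // /eqP L0.
by move: (sample_neq0 nf_gt0 sL); rewrite L0 eqxx.
Qed.

(** The decider collected only [Some a], so every other quorum contains [Some a] too, and by
    [lock_unique] its locks other than [?] are all [a]. *)
Lemma decided_finishes i j r a w d :
  finishes i r a true -> finishes j r w d -> w = a.
Proof.
move=> /finishes_decided[L sL EL]; case/finishes_spec=> L' sL' h.
have aL' : Some a \in L'.
  have [|x] := sample_meet nf_maj _ sL sL'; last by rewrite EL => /set1P->.
  by move=> k x y [u h1] [u' h2]; case: (said_lock_inj h1 h2).
have [k [u ku]] : exists k u, said k (Lock r (Some a) u).
  by case: sL' => _ /(_ _ aL').
case: h => [[_ Ew _]|[/eqP/setP/(_ (Some a))]]; last by rewrite !inE aL'.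
have : w \in [set x | Some x \in L'].
  by rewrite Ew vmin_in //; apply/set0Pn; exists a; rewrite inE.
rewrite inE => wL'; case: sL' => _ /(_ _ wL')[k' [u' ku']].
exact: lock_unique ku' ku.
Qed.

(** The round after the decision is unanimous by [decided_finishes]; unanimity then persists by
    [finishes_constant]. *)
Lemma decided_proposes i r a r' : finishes i r a true -> r < r' ->
  forall j w, said j (Propose r' w) -> w = a.
Proof.
move=> ia; elim: r' => // r' IH; rewrite ltnS leq_eqVlt => /orP[/eqP<-|lt] j w.
  by case/proposesS_finishes=> d; apply: decided_finishes ia.
case/proposesS_finishes=> d jf.
by have [] := finishes_constant (IH lt) jf.
Qed.

Lemma decided_agree i j r r' a b :
  finishes i r a true -> finishes j r' b true -> a = b.
Proof.
wlog le : i j r r' a b / r <= r' => [W ia jb|ia jb].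
  by case: (leqP r r') => [/W/(_ ia jb)|/ltnW/W/(_ jb ia)].
move: le; rewrite leq_eqVlt => /orP[/eqP E|lt].
  by rewrite -E in jb; rewrite (decided_finishes ia jb).
by have [->] := finishes_constant (decided_proposes ia lt) jb.
Qed.

Lemma finishes_locked i r w d :
  finishes i r w d -> exists j l, said j (Lock r l w).
Proof.
case/finishes_spec=> L sL [[L0 Ew _]|[_ _ [B sB ->]]].
  have : w \in [set x | Some x \in L].
    rewrite Ew; apply: vmin_in.
    move/set0Pn: L0 => [[x|]]; rewrite !inE //= => xL.
    by apply/set0Pn; exists x; rewrite inE.
  rewrite inE => wL; case: sL => _ /(_ _ wL)[j [u ju]].
  (* A lock on [w] is sent together with the value [w] itself. *)
  by exists j, (Some w); rewrite -{2}(lock_value ju).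
have := vmin_in (sample_neq0 nf_gt0 sB).
by case: sB => _ /[apply] -[j [l jl]]; exists j, l.
Qed.

Lemma lock_proposed i r l w :
  said i (Lock r l w) -> exists j, said j (Propose r w).
Proof.
case/said_lock_spec=> A [sA -> _].
by have := vmin_in (sample_neq0 nf_gt0 sA); case: sA => _ /[apply].
Qed.

(** A value is traced backwards, from proposal to the end of the previous round, to a lock message,
    to a proposal, down to the inputs. *)
Lemma propose_valid i r w : said i (Propose r w) -> exists j, input j = w.
Proof.
elim: r i => [|r IH] i; first by move=> /proposes0_input->; exists i.
by case/proposesS_finishes=> d /finishes_locked[j [l /lock_proposed[k /IH]]].
Qed.

Lemma finishes_valid i r w d : finishes i r w d -> exists j, input j = w.
Proof. by case/finishes_locked=> j [l /lock_proposed[k /propose_valid]]. Qed.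

(** The bound on the deciding round shows that a decided process standing at L7 decided in a
    strictly earlier round. *)
Lemma decision_inv i t :
  (forall w, w \in decisions (st t i) -> exists r, finishes i r w true) /\
  (var_decided (st t i) -> exists r w, finishes i r w true /\
     (r < var_r (st t i) \/ pc (st t i) = L12 /\ r = var_r (st t i))).
Proof.
elim: t => [|t]; first by rewrite state0.
have fin : pc (st t.+1 i) = L12 -> var_decided (st t.+1 i) ->
    finishes i (var_r (st t.+1 i)) (var_v (st t.+1 i)) true.
  by move=> pc12 dec1; exists t.+1.
case: (process_step i t) fin => [//|j m _||m].
- case: (st t i) => [] [] // v lk dec r p lc rc pd ds _ _ [IH1 IH2] /=;
    case: ifP => _; split=> // /IH2 [r' [w [h [|[]//]]]];
    by exists r', w; split; auto.
- case: (st t i) => [] [] //= v lk dec r p lc rc pd ds _ fin [IH1 IH2];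
    try by split=> // /IH2 [r' [w [h [|[]//]]]]; exists r', w; split; auto.
  + move: fin; case: ifP => _; last first.
      by split=> // /IH2 [r' [w [h [|[]//]]]]; exists r', w; split; auto.
    case: ifP => _ /= fin; last first.
      by split=> // /IH2 [r' [w [h [|[]//]]]]; exists r', w; split; auto.
    have {}fin := fin erefl isT; split.
      move=> w; rewrite mem_rcons inE => /orP[/eqP->|/IH1//].
      by exists r.
    by move=> _; exists r, (vmin [set w | Some w \in lc]); split; auto.
  + split=> // /IH2 [r' [w [h h']]]; exists r', w; split=> //; left.
    by case: h' => [/ltnW//|[_ ->]].
- by case: (st t i).
Qed.

Lemma decides_finishes i w : decides conf i w -> exists r, finishes i r w true.
Proof. by case=> t /(decision_inv i t).1. Qed.

(** * Liveness: progress of correct processes *)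

Hypothesis fp : failure_pattern f F.
Hypothesis adm : admissible F H.

Local Notation C := (correct F).

Lemma card_correct : #|C| = n - #|crashed F|.
Proof. by rewrite /correct cardsCs setCK card_ord. Qed.

Lemma failure_mono t t' : t <= t' -> F t \subset F t'.
Proof.
case: fp => sF _ _; elim: t' => [|t' IH]; first by rewrite leqn0 => /eqP->.
rewrite leq_eqVlt => /orP[/eqP->//|/IH h]; exact: subset_trans h (sF _).
Qed.

Lemma crashed_time :
  exists T, forall t p, T <= t -> p \in crashed F -> p \in F t.
Proof.
have /fin_all_exists[g gP] p : exists t, p \in crashed F -> p \in F t.
  have [|] := boolP (p \in crashed F); last by exists 0.
  by rewrite inE => /asboolP[t pt]; exists t.
exists (\max_p g p) => t p le /gP; apply/subsetP/failure_mono.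
by apply: leq_trans le; apply: leq_bigmax.
Qed.

(** Completeness bounds [n - H i t], and [n - f] is small enough because at most [f] processes
    crash. *)
Lemma alive_eventually_le :
  exists T, forall t i, T <= t -> alive f H i t <= #|C|.
Proof.
case: adm fp => -[T hT] _ [_ _ cf]; exists T => t i le; have := hT t i le.
rewrite card_correct geq_max; lia.
Qed.

(** Forgets [received], the only field that changes between two steps of a process of its own. *)
Definition erase (s : local n) : local n :=
  let: Local l v lk dec r prop lckd _ pend ds := s in
  Local l v lk dec r prop lckd [::] pend ds.

Definition own_step i t : Prop :=
  [/\ outgoing (st t i) = None
     & st t.+1 i = exec (alive f H i t) (st t i)]
  \/ (outgoing (st t i) <> None
      /\ exists2 j, j \in pending (st t i) & st t.+1 i = sent j (st t i)).

Lemma is_step_own i t : is_step_of i (ev t) -> own_step i t.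
Proof.
have := exec_step exn t; move=> h [e|[j e]]; move: h; rewrite e /=.
  by case=> _ om h; left; split=> //; rewrite h /= ffunE eqxx.
case=> _ jp [m om h]; right; rewrite om; split=> //.
by exists j; rewrite // h /= ffunE eqxx.
Qed.

Lemma not_step_erase i t :
  ~ is_step_of i (ev t) -> erase (st t.+1 i) = erase (st t i).
Proof.
have := exec_step exn t; case: (ev t) => [-> //|k j|k|k j m] /=.
- case=> _ _ [m _ ->] nk; rewrite /= ffunE; case: eqP => // E.
  by case: nk; right; exists j; rewrite E.
- case=> _ _ -> nk; rewrite /= ffunE; case: eqP => // E.
  by case: nk; left; rewrite E.
- case=> _ _ -> _; rewrite /= ffunE; case: eqP => // <-.
  by case: (st t i).
Qed.

(** The first step of [i] granted by fairness: before it, only receptions occur at [i]. *)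
Lemma next_step i t : i \in C ->
  exists t', [/\ t <= t', erase (st t' i) = erase (st t i) & own_step i t'].
Proof.
move=> iC; have [t1 le] := exec_fair exn iC t.
rewrite -(subnKC le); move: (t1 - t) => d {t1 le}.
elim: d t => [|d IH] t is_step.
  by rewrite addn0 in is_step; exists t; split=> //; apply: is_step_own.
have [is_step0|/not_step_erase same] := pselect (is_step_of i (ev t)).
  by exists t; split=> //; apply: is_step_own.
have [|t' [le e h]] := IH t.+1; first by rewrite addSnnS.
by exists t'; split; [apply: ltnW | rewrite e | ].
Qed.

Lemma erase_core (s s' : local n) : erase s = erase s' ->
  core s = core s' /\ pending s = pending s'.
Proof.
by case: s s' => ? ? ? ? ? ? ? ? ? ? [? ? ? ? ? ? ? ? ? ?] [] *; subst.
Qed.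

Lemma next_exec i t : i \in C -> outgoing (st t i) = None -> exists t',
  [/\ t <= t', erase (st t' i) = erase (st t i)
    & st t'.+1 i = exec (alive f H i t') (st t' i)].
Proof.
move=> iC om; have [t' [le e [[_ h]|[]]]] := next_step t iC; first by exists t'.
by case; rewrite (core_outgoing (erase_core e).1).
Qed.

Definition reach i l r : Prop :=
  exists t, pc (st t i) = l /\ var_r (st t i) = r.

Lemma reach_broadcast (first : bool) i r : i \in C ->
  reach i (if first then L1 else L6) r -> reach i (if first then L2 else L7) r.
Proof.
move=> iC [t [pct rt]].
(* Induction on a bound for the number of recipients still to be served. *)
elim: {t}_.+1 {-2}t (ltnSn #|pending (st t i)|) pct rt => // k IH t lek pct rt.
have [t' [_ e [[+ _]|[_ [j jp h]]]]] := next_step t iC.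
  by rewrite (core_outgoing (erase_core e).1) /outgoing pct; case: (first).
have [[E1 _ _ _ E2] E3] := erase_core e.
rewrite pct in E1; rewrite rt in E2; rewrite -E3 in lek.
have := IH t'.+1; rewrite h /reach => {}IH.
have : exists2 s, s = st t'.+1 i & s = sent j (st t' i) by exists (st t'.+1 i).
move: E1 E2 jp lek IH.
case: (st t' i) => l v lk dec r' p lc rc pd ds /= -> -> jp lek.
case: ifP => [_ _ [s e1 e2]|_ IH _].
  by exists t'.+1; rewrite -e1 e2; case: (first).
by apply: IH => //=; move: lek; rewrite (cardsD1 j pd) jp add1n ltnS.
Qed.

Lemma exec_line l l' i r : i \in C ->
  (forall s : local n, pc s = l -> outgoing s = None /\
     forall fd, pc (exec fd s) = l' /\ var_r (exec fd s) = var_r s) ->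
  reach i l r -> reach i l' r.
Proof.
move=> iC ll' [t [pct rt]]; have [om _] := ll' _ pct.
have [t' [_ e h]] := next_exec iC om.
have [E1 E2] : pc (st t' i) = l /\ var_r (st t' i) = r.
  by have [[-> _ _ _ ->] _] := erase_core e.
have [_ /(_ (alive f H i t'))[]] := ll' _ E1; rewrite -h E2 => *.
by exists t'.+1.
Qed.

Lemma reach_lock_line i r : i \in C -> reach i L3 r -> reach i L6 r.
Proof.
move=> iC h; apply: (exec_line iC (l := L5)); first by case=> [] [].
apply: (exec_line iC (l := L4)); first by case=> [] [].
by apply: (exec_line iC (l := L3)) => //; case=> [] [].
Qed.

Lemma reach_end i r : i \in C -> reach i L9 r -> reach i L12 r.
Proof.
move=> iC h; have {h} : reach i L10 r.
  by apply: (exec_line iC (l := L9)) => //; case=> [] [].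
case=> t [pct rt]; have om : outgoing (st t i) = None by rewrite /outgoing pct.
have [t' [_ e h]] := next_exec iC om.
have [[E1 _ _ _ E2] _] := erase_core e.
have : reach i L11 r \/ reach i L12 r.
  move: E1 E2 h; rewrite pct rt.
  case: (st t' i) => l v lk dec r' p lc rc pd ds /= -> ->.
  case: ifP => _; last by left; exists t'.+1; rewrite h.
  by case: ifP => _; right; exists t'.+1; rewrite h.
by case=> //; apply: (exec_line iC (l := L11)) => //; case=> [] [].
Qed.

Lemma reach_next i r : i \in C -> reach i L12 r -> reach i L1 r.+1.
Proof.
move=> iC [t [pct rt]].
have om : outgoing (st t i) = None by rewrite /outgoing pct.
have [t' [_ e h]] := next_exec iC om.
have [[E1 _ _ _ E2] _] := erase_core e.
move: E1 E2 h; rewrite pct rt.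
case: (st t' i) => l v lk dec r' p lc rc pd ds /= -> -> h.
by exists t'.+1; rewrite h.
Qed.

Lemma delivered_mono t t' e a :
  t <= t' -> count a (delivered t e) <= count a (delivered t' e).
Proof.
elim: t' => [|t' IH]; first by rewrite leqn0 => /eqP->.
rewrite leq_eqVlt => /orP[/eqP->//|/IH h]; apply: leq_trans h _ => /=.
by case: (ev t') => // i k m; case: ifP => //= _; apply: leq_addl.
Qed.

Lemma sent_delivered i j m t : i \in C ->
  m \in sent_log t (j, i) -> exists t', m \in delivered t' (j, i).
Proof.
move=> iC; rewrite mem_count -count_channel.
case: (posnP (count (pred1 m) (delivered t (j, i)))) => [->|h _]; last first.
  by exists t; rewrite mem_count.
(* Reliability names senders through [Pi], so [j] is written as the image of its anonymous name. *)
rewrite add0n -mem_count -[j](permKV Pi) => mc.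
have [t' _ ev'] := exec_reliable exn iC mc.
by exists t'.+1; rewrite /= ev' eqxx inE eqxx.
Qed.

(** A correct process past the rank has sent to [i], and reliability delivers; [T] is the latest of
    the chosen delivery times. *)
Lemma eventually_received i m0 : i \in C ->
  (forall j, j \in C -> exists t, message_rank m0 < rank (st t j)) ->
  exists T, forall t, T <= t ->
    #|C| <= count [pred m | message_rank m == message_rank m0]
              (received (st t i)).
Proof.
move=> iC allC; pose a := [pred m | message_rank m == message_rank m0].
have /fin_all_exists[g gP] j :
    exists t, j \in C -> 0 < count a (delivered t (j, i)).
  have [jC|] := boolP (j \in C); last by exists 0.
  have [t lt] := allC j jC.
  have : has a (sent_log t (j, i)) by rewrite has_count count_sent lt.
  case/hasP=> m /(sent_delivered iC)[t' md] am.
  by exists t' => _; rewrite -has_count; apply/hasP; exists m.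
exists (\max_j g j) => t le; rewrite count_received -sum1_card big_mkcond /=.
apply: leq_sum => j _; case: ifP => // jC.
apply: leq_trans (gP j jC) _; apply: delivered_mono.
by apply: leq_trans le; apply: leq_bigmax.
Qed.

Lemma reach_wait (first : bool) i r : i \in C ->
  (forall j, j \in C -> reach j (if first then L2 else L7) r) ->
  reach i (if first then L2 else L8) r -> reach i (if first then L3 else L9) r.
Proof.
move=> iC sentC [t0 [pc0 r0]].
set m0 := if first then Propose r true else Lock r None true.
have [j /sentC[t [pct rt]]|T1 hT1] := @eventually_received i m0 iC.
  by exists t; rewrite /m0 /rank pct rt; case: (first) => /=; lia.
have [T2 hT2] := alive_eventually_le.
have wait t : t0 <= t -> reach i (if first then L3 else L9) r \/
    (pc (st t i) = (if first then L2 else L8) /\ var_r (st t i) = r).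
  elim: t => [|t IH].
    by rewrite leqn0 => /eqP E; rewrite E in pc0 r0; right.
  rewrite leq_eqVlt => /orP[/eqP E|/IH[|]];
    [by rewrite E in pc0 r0; right|by left|].
  case=> pct rt.
  have [s es stp] : exists2 s, st t.+1 i = s
      & local_step (alive f H i t) (st t i) s.
    by exists (st t.+1 i); last apply: process_step.
  case: stp es => [|j m _ + _|_|m].
  + by rewrite -pct -rt => ->; right.
  + by rewrite /outgoing pct; case: (first).
  + move=> es; suff : pc (st t.+1 i) = (if first then L3 else L9)
      /\ var_r (st t.+1 i) = r
      \/ pc (st t.+1 i) = (if first then L2 else L8) /\ var_r (st t.+1 i) = r.
      by case; [left; exists t.+1 | right].
    rewrite es; move: pct rt.
    case: (st t i) => l v lk dec r' p lc rc pd ds /= -> ->.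
    by case: (first) => /=; case: ifP; auto.
  + move=> es; right; rewrite es; move: pct rt.
    by case: (st t i) => l v lk dec r' p lc rc pd ds /=.
(* If the wait is not over by then, all correct processes have been heard and the detector asks for
   no more than their number, so the next poll succeeds. *)
have [//|[pct rt]] := wait _ (leq_maxl t0 (maxn T1 T2)).
set t := maxn _ _ in pct rt.
have om : outgoing (st t i) = None by rewrite /outgoing pct; case: (first).
have [t' [le e h]] := next_exec iC om.
have [[E1 _ _ _ E2] _] := erase_core e.
have le1 : T1 <= t' by apply: leq_trans le; rewrite /t; lia.
have le2 : T2 <= t' by apply: leq_trans le; rewrite /t; lia.
exists t'.+1; rewrite h.
move: E1 E2 (leq_trans (hT2 t' i le2) (hT1 t' le1)); rewrite pct rt.
case: (st t' i) => l v lk dec r' p lc rc pd ds /= -> ->; rewrite /m0.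
case: (first) => /= al.
  by rewrite (eq_count (is_proposeE r)) al.
by rewrite (eq_count (is_lockE r)) al.
Qed.

(** The goal is L7 and not L12, since a process that has decided still broadcasts its lock before
    halting. *)
Lemma reach_L7 r : (forall i, i \in C -> reach i L1 r) ->
  forall i, i \in C -> reach i L7 r.
Proof.
move=> all1; have all2 i : i \in C -> reach i L2 r.
  by move=> iC; apply: (reach_broadcast (first := true) iC (all1 i iC)).
move=> i iC; apply: (reach_broadcast (first := false) iC).
apply: reach_lock_line => //.
exact: (reach_wait (first := true) iC all2 (all2 i iC)).
Qed.

Lemma reach_L12 r i t : (forall j, j \in C -> reach j L7 r) -> i \in C ->
  pc (st t i) = L7 -> var_r (st t i) = r -> var_decided (st t i) = false ->
  reach i L12 r.
Proof.
move=> all7 iC pct rt dt; apply: reach_end => //.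
apply: (reach_wait (first := false) iC all7).
have om : outgoing (st t i) = None by rewrite /outgoing pct.
have [t' [_ e h]] := next_exec iC om.
have [[E1 _ _ E2 E3] _] := erase_core e.
move: E1 E2 E3 h; rewrite pct rt dt.
case: (st t' i) => l v lk dec r' p lc rc pd ds /= -> -> -> h.
by exists t'.+1; rewrite h.
Qed.

Lemma undecided_finishes i r : i \in C ->
  (forall t, var_decided (st t i) = false) ->
  (forall j, j \in C -> reach j L7 r) -> exists w, finishes i r w false.
Proof.
move=> iC und all7; have [t [pct rt]] := all7 i iC.
have [t' [pct' rt']] := reach_L12 all7 iC pct rt (und t).
by exists (var_v (st t' i)), t'; split=> //; apply: und.
Qed.

Lemma undecided_reach i0 : i0 \in C ->
  (forall t, var_decided (st t i0) = false) ->
  forall r i, i \in C -> reach i L1 r.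
Proof.
move=> i0C und; elim=> [|r IH] i iC; first by exists 0; rewrite state0.
have all7 := reach_L7 IH; have [t [pct rt]] := all7 i iC.
apply: reach_next => //; case dt: (var_decided (st t i)); last first.
  exact: reach_L12 all7 iC pct rt dt.
(* A process halting here decided before round [r], which is thus unanimous; then [i0], which
   completes it, would decide as well. *)
have [_ /(_ dt)[r' [a [ia]]]] := decision_inv i t.
rewrite pct rt => -[lt|[]//].
have [w fw] := undecided_finishes i0C und all7.
by have [] := finishes_constant (decided_proposes ia lt) fw.
Qed.

(** * Late rounds and termination *)

Definition late R := forall t i, R <= var_r (st t i) ->
  i \in C /\ #|C| <= alive f H i t.

(** [R] exceeds every round entered by a time [T] at which the crashes are over and accuracy holds.
    A process in round [R] or later has moved after [T], hence is correct. *)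
Lemma late_round : exists R, late R.
Proof.
have [T0 hT0] := crashed_time; case: adm => _ [T1 hT1].
pose T := maxn T0 T1; exists (\max_i var_r (st T i)).+1 => t i lt.
have Ti : var_r (st T i) < var_r (st t i).
  apply: leq_trans lt; rewrite ltnS.
  exact: (leq_bigmax (F := fun i => var_r (st T i))).
have Tt : T < t.
  by rewrite ltnNge; apply/negP=> /(round_mono i); rewrite leqNgt Ti.
have iC : i \in C.
  rewrite inE; apply/negP=> icr.
  suff E : st t i = st T i by rewrite E ltnn in Ti.
  rewrite -(subnKC (ltnW Tt)); elim: (t - T) => [|d IH]; first by rewrite addn0.
  rewrite addnS crashed_stay //; apply: hT0 => //.
  by rewrite /T; lia.
split=> //; have := hT1 t i _ iC; rewrite card_correct => h.
have {}h : H i t <= #|crashed F| by apply: h; rewrite /T in Tt; lia.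
by apply: leq_trans (leq_maxl _ _); lia.
Qed.

Lemma undecided_false i0 : i0 \in C ->
  ~ (forall t, var_decided (st t i0) = false).
Proof.
move=> i0C und; have [R lateR] := late_round.
have all1 := undecided_reach i0C und.
have fin0 r := undecided_finishes i0C und (reach_L7 (all1 r)).
(* From round [R] on, a wait requires as many messages as there are correct processes. *)
pose th r := if R <= r then #|C| else n - f.
have th_alive t i : pc (st t i) = L2 \/ pc (st t i) = L8 ->
    th (var_r (st t i)) <= alive f H i t.
  move=> pct; rewrite /th; case: ifP => [/lateR[]//|_].
  exact: th0 pct.
(* [13 * R] is the rank of L1 in round [R]. *)
have saidC j m : 13 * R <= message_rank m -> said j m -> j \in C.
  move=> le [t om]; apply: (lateR t j _).1.
  move: le; rewrite (outgoing_rank om) /rank.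
  have : line_index (pc (st t j)) < 13 by case: (pc _).
  lia.
have thR : th R = #|C| by rewrite /th leqnn.
(* Both messages stem from samples of size [#|C|] whose sources all lie in [C], so the samples
   coincide. *)
have lock_eq i j l l' w w' : said i (Lock R l w) -> said j (Lock R l' w') ->
    l = l' /\ w = w'.
  move=> /(lockedP th_alive)[A [sA -> ->]] /(lockedP th_alive)[B [sB -> ->]].
  rewrite thR in sA sB; suff -> : A = B by [].
  apply: sample_full sA sB => [k x y|k x]; first exact: said_propose_inj.
  by apply: saidC => /=.
have [w0 fw0] := fin0 R.
have [i1 [l1 [w1 i1l1]]] : exists i l w, said i (Lock R l w).
  have [L [[S kS SL] _] _] := finishes_spec fw0.
  have /card_gt0P[j /SL[l _ [u jlu]]] := leq_trans nf_gt0 kS.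
  by exists j, l, u.
have locked1 k L : 0 < k -> locked_sample k R L -> L = [set l1].
  move=> k0 sL; apply: (sample_const k0 _ sL) => j l [u jl].
  by have [] := lock_eq _ _ _ _ _ _ jl i1l1.
(* If the common lock is a value, [i0] collected nothing else in round [R] and decided, a
   contradiction. *)
case: l1 i1l1 locked1 => [a|] i1l1 locked1.
  have [L /(locked1 _ _ nf_gt0)-> [[_ -> /esym]|[]]] := finishes_spec fw0.
    have -> : [set x | Some x \in [set Some a]] = [set a].
      by apply/setP=> x; rewrite !inE; apply/eqP/eqP => [[]|->].
    by rewrite vmin1 setDv eqxx.
  by move/eqP/setP/(_ (Some a)); rewrite !inE eqxx.
(* If it is [?], round [R] ends with the minimum of value entries all equal to [w1], so round [R.+1]
   is unanimous and [i0] decides there. *)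
have next_w1 j w : said j (Propose R.+1 w) -> w = w1.
  case/(proposesS th_alive)=> d /finishes_spec[L /(locked1 _ _ nf_gt0)->].
  case=> [[]|[_ _ [B sB ->]]]; first by rewrite setDv eqxx.
  have -> : B = [set w1]; last exact: vmin1.
  apply: (sample_const nf_gt0 _ sB) => k x [l kx].
  by have [] := lock_eq _ _ _ _ _ _ kx i1l1.
have [w fw] := fin0 R.+1.
by have [] := finishes_constant next_w1 fw.
Qed.

Lemma terminates : termination F conf.
Proof.
move=> i iC; have [[t dt]|nd] := pselect (exists t, var_decided (st t i)).
  have [e _ _ _] := local_invP i t; move: e; rewrite dt.
  case E: (decisions (st t i)) => [//|w ds] _.
  by exists w, t; rewrite E inE eqxx.
case: (undecided_false iC) => t; apply/negbTE/negP => dt.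
by apply: nd; exists t.
Qed.

End Execution.

Theorem theorem2p9 (n f : nat) (Pi : {perm 'I_n}) (F : nat -> {set 'I_n})
    (H : 'I_n -> nat -> 'I_n.+1) (input : 'I_n -> bool)
    (ev : nat -> event n) (conf : nat -> config n) :
  2 * f < n ->
  failure_pattern f F ->
  admissible F H ->
  execution f Pi F H input ev conf ->
  [/\ termination F conf,
      irrevocability conf,
      agreement F conf
    & validity input conf].
Proof.
move=> nf fp adm exn; have n_gt0 : 0 < n by apply: leq_ltn_trans nf.
split.
- exact: terminates exn nf fp adm.
- move=> i t; have [-> _ _ _] := local_invP n_gt0 exn i t.
  by case: (var_decided _).
- move=> i j w w' _ _ /(decides_finishes exn)[r iw].
  move=> /(decides_finishes exn)[r' jw'].
  exact: (decided_agree n_gt0 exn nf iw jw').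
- move=> i w /(decides_finishes exn)[r iw].
  exact: (finishes_valid n_gt0 exn nf iw).
Qed.
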